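(* Let $(X,\mathcal{U})$ be a quasi-uniform space (not necessarily $T_0$) and let $T\colon X\to X$ be an order-preserving involution. If there exists $x^*\in X$ with $U(x^* )\cap U^{-1}(Tx^* )\neq\emptyset$ for every $U\in\mathcal{U}$, then $T(x^* )\equiv_{\mathcal{U}}x^*$. In particular, $\pi(x^* )$ is a fixed point of $\widetilde T$ in $\widetilde X$, i.e. $\widetilde T(\pi(x^* ))=\pi(x^* )$, and when $\mathcal{U}$ is $T_0$ this gives $T(x^* )=x^*$.
   Context: $X$ is a non-empty set. A quasi-uniformity on $X$ is a filter $\mathcal{U}$ on $X\times X$ such that every $U\in\mathcal{U}$ contains the diagonal $\Delta_X$ and for every $U\in\mathcal{U}$ there is $V\in\mathcal{U}$ with $V\circ V\subseteq U$, where $V\circ V=\{(x,z):\exists y,\ (x,y)\in V,\ (y,z)\in V\}$. For $U\in\mathcal{U}$ and $x\in X$: $U^{-1}=\{(x,y):(y,x)\in U\}$, $U(x)=\{y\in X:(x,y)\in U\}$ and $U^{-1}(x)=\{y\in X:(y,x)\in U\}$. The relation $\bigcap\mathcal{U}:=\bigcap_{U\in\mathcal{U}}U$ is a preorder on $X$; $\mathcal{U}$ is $T_0$ if it is antisymmetric. Write $x\equiv_{\mathcal{U}}y$ if $(x,y)\in\bigcap\mathcal{U}$ and $(y,x)\in\bigcap\mathcal{U}$; this is an equivalence relation. $\widetilde X:=X/{\equiv_{\mathcal{U}}}$ and $\pi\colon X\to\widetilde X$ is the quotient map. A map $T\colon X\to X$ is order-preserving if $(x,y)\in\bigcap\mathcal{U}$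 implies $(Tx,Ty)\in\bigcap\mathcal{U}$; it is an involution if $T\circ T=\mathrm{id}_X$. An order-preserving $T$ respects $\equiv_{\mathcal{U}}$ and so induces the well-defined map $\widetilde T\colon\widetilde X\to\widetilde X$, $\widetilde T(\pi(x))=\pi(Tx)$. *)

(* Defs.v *)
From mathcomp Require Import all_boot.
From mathcomp Require Import all_classical.

Set Implicit Arguments.
Unset Strict Implicit.
Unset Printing Implicit Defensive.

Local Open Scope classical_set_scope.
Local Open Scope quotient_scope.

Record quasiUniformity (X : Type) := QuasiUniformity {
  qu_entourage : set_system (X * X);
  qu_filter : ProperFilter qu_entourage;
  qu_diagonal : forall U, qu_entourage U -> diagonal `<=` U;
  qu_split : forall U, qu_entourage U ->
    exists2 V, qu_entourage V & ((V \; V)%relation `<=` U)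
}.

Section QuasiUniformity.
Variables (X : Type) (U : quasiUniformity X).

Definition qu_le : set (X * X) := \bigcap_(V in qu_entourage U) V.

Lemma qu_le_refl x : qu_le (x, x).
Proof. by move=> V UV; exact: (qu_diagonal UV). Qed.

Lemma qu_le_trans y x z : qu_le (x, y) -> qu_le (y, z) -> qu_le (x, z).
Proof.
move=> xy yz V UV; have [W UW WV] := qu_split UV.
by apply: WV; exists y; [exact: xy|exact: yz].
Qed.

Definition qu_T0 := forall x y, qu_le (x, y) -> qu_le (y, x) -> x = y.

Definition qu_equiv (x y : X) := qu_le (x, y) /\ qu_le (y, x).

Definition order_preserving (T : X -> X) :=
  forall x y, qu_le (x, y) -> qu_le (T x, T y).

(* [{eq_quot _}] needs a boolean relation on a choiceType, hence the classical
   choice structure [{classic X}] (convertible to [X]) and the reflection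
   of the propositional relation into bool. *)
Definition qu_equivb : rel {classic X} := fun x y => `[< qu_equiv x y >].

Lemma qu_equivb_refl : reflexive qu_equivb.
Proof. by move=> x; apply/asboolP; split; exact: qu_le_refl. Qed.

Lemma qu_equivb_sym : symmetric qu_equivb.
Proof. by move=> x y; apply/asboolP/asboolP => -[]. Qed.

Lemma qu_equivb_trans : transitive qu_equivb.
Proof.
move=> y x z /asboolP[xy yx] /asboolP[yz zy]; apply/asboolP.
by split; [exact: qu_le_trans xy yz|exact: qu_le_trans zy yx].
Qed.

Canonical qu_equiv_rel :=
  EquivRel qu_equivb qu_equivb_refl qu_equivb_sym qu_equivb_trans.

Definition qu_quot := {eq_quot qu_equiv_rel}.

Definition qu_pi (x : X) : qu_quot := \pi_qu_quot (x : {classic X}).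

Lemma qu_piP x y : qu_pi x = qu_pi y <-> qu_equiv x y.
Proof.
by split=> [/eqquotP/asboolP//|xy]; apply/eqquotP/asboolP.
Qed.

Lemma qu_pi_surj (q : qu_quot) : exists x, qu_pi x = q.
Proof. by exists (repr q); rewrite /qu_pi reprK. Qed.

(* [T] is applied to a chosen representative; for order-preserving [T] the
   result does not depend on that choice, see [qu_quot_map_pi]. *)
Definition qu_quot_map (T : X -> X) (q : qu_quot) : qu_quot :=
  qu_pi (T (repr q)).

Lemma qu_quot_map_pi (T : X -> X) : order_preserving T ->
  forall x, qu_quot_map T (qu_pi x) = qu_pi (T x).
Proof.
move=> opT x; apply/qu_piP.
have /qu_piP[le ge] : qu_pi (repr (qu_pi x)) = qu_pi x by rewrite /qu_pi reprK.
by split; exact: opT.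
Qed.

End QuasiUniformity.

(* Main.v *)
Require Import Defs.
From mathcomp Require Import all_boot.
From mathcomp Require Import all_classical.

Local Open Scope classical_set_scope.

(** A point [y] in the intersection for [W] gives a two-step [W]-chain from [xs] through [y] to
    [T xs]. As every entourage contains some [W \; W], [xs] lies below [T xs] in the preorder
    [qu_le U]. *)

Theorem theorem8p2 (X : Type) (X_nonempty : [set: X] !=set0)
  (U : quasiUniformity X) (T : X -> X)
  (T_order : order_preserving U T) (T_invol : involutive T)
  (xs : X)
  (xs_meet : forall V : set (X * X), qu_entourage U V ->
    (xsection V xs `&` xsection (V^-1)%relation (T xs)) !=set0) :
  [/\ qu_equiv U (T xs) xs,
      qu_quot_map T (qu_pi U xs) = qu_pi U xs
    & qu_T0 U -> T xs = xs].
Proof.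
have le_xs : qu_le U (xs, T xs).
  move=> V UV; have [W UW WV] := qu_split UV.
  have [y [/xsectionP xsy /xsectionP yTxs]] := xs_meet W UW.
  by apply: WV; exists y.
(* Applying the monotone [T] to [le_xs] reverses it, since [T (T xs) = xs]. *)
have ge_xs : qu_le U (T xs, xs) by have := T_order _ _ le_xs; rewrite T_invol.
split; first by split.
- by rewrite qu_quot_map_pi //; apply/qu_piP; split.
- by move=> T0; exact: T0.
Qed.
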